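(* Let $I=(n,T,W)$ be a feasible ordered instance and let $S=\mathrm{Leftmost}(I)$. Then (1) $S$ is an ordered solution for $I$, and (2) for every ordered solution $X$ for $I$ and every $i\in[1..n]$, $S[i]\le X[i]$.
   Context: Single processor, unit-length tasks. A window is a closed real interval; a slot is a closed real interval of length $1$; intervals overlap iff their interiors intersect. An instance $I=(n,T,W)$ consists of tasks $T[1..n]$ with windows $W[1..n]$. A solution assigns to each $T[i]$ a slot $S[i]\subseteq W[i]$ with no two slots overlapping; $I$ is feasible iff it has a solution. Intervals are partially ordered by $X\le Y$ iff $X.\mathrm{start}\le Y.\mathrm{start}$ and $X.\mathrm{end}\le Y.\mathrm{end}$; a sequence of intervals is ordered iff its (non-null) elements are increasing in this order; $I$ is ordered iff $W[1..n]$ is ordered; a solution is ordered iff $S[1..n]$ is ordered. $\mathrm{Leftmost}(I)$ is defined by: $S[0].\mathrm{end}=-\infty$, and for $i=1,\dots,n$, $S[i].\mathrm{start}=\max(W[i].\mathrm{start},S[i-1].\mathrm{end})$, $S[i].\mathrm{end}=S[i].\mathrm{start}+1$; it returns $S[1..n]$. *)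

(* Defs.v *)
From HB Require Import structures.
From mathcomp Require Import all_boot all_order all_algebra.
From mathcomp Require Import all_classical all_reals all_analysis.
Import Order.TTheory GRing.Theory Num.Theory.
Import numFieldNormedType.Exports.

Set Implicit Arguments.
Unset Strict Implicit.
Unset Printing Implicit Defensive.

Local Open Scope classical_set_scope.
Local Open Scope ring_scope.

Record cinterval (R : realType) := CInterval {
  istart : R;
  iend : R;
  istart_le_iend : istart <= iend
}.

Definition iset (R : realType) (X : cinterval R) : set R :=
  [set` `[istart X, iend X]].

Definition is_slot (R : realType) (X : cinterval R) : Prop :=
  iend X - istart X = 1.

Definition overlap (R : realType) (X Y : cinterval R) : Prop :=
  (iset X)° `&` (iset Y)° !=set0.

(* This is neither inclusion nor the "lies entirely before" order. *)
Definition ile (R : realType) (X Y : cinterval R) : bool :=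
  (istart X <= istart Y) && (iend X <= iend Y).

(* Increasing is meant weakly: equal intervals may occur in the sequence. *)
Definition ordered_seq (R : realType) (s : seq (cinterval R)) : Prop :=
  pairwise (@ile R) s.

(* The tasks are mere labels: sequences are indexed by 'I_n, so that the
   entry written [i] for 1 <= i <= n is the entry of index i - 1 here. *)
Record instance (R : realType) (Task : Type) := Instance {
  ntasks : nat;
  task : ntasks.-tuple Task;
  window : ntasks.-tuple (cinterval R)
}.

Definition is_solution (R : realType) (Task : Type) (I : instance R Task)
    (S : (ntasks I).-tuple (cinterval R)) : Prop :=
  [/\ forall i, is_slot (tnth S i),
      forall i, iset (tnth S i) `<=` iset (tnth (window I) i)
    & forall i j, i != j -> ~ overlap (tnth S i) (tnth S j)].

Arguments is_solution {R Task} I S.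

Definition feasible (R : realType) (Task : Type) (I : instance R Task) : Prop :=
  exists S : (ntasks I).-tuple (cinterval R), is_solution I S.

Definition ordered_instance (R : realType) (Task : Type)
    (I : instance R Task) : Prop :=
  ordered_seq (window I).

Definition ordered_solution (R : realType) (Task : Type) (I : instance R Task)
    (S : (ntasks I).-tuple (cinterval R)) : Prop :=
  is_solution I S /\ ordered_seq S.

Arguments ordered_solution {R Task} I S.

Lemma le_add1 (R : realType) (x : R) : x <= x + 1.
Proof. by rewrite lerDl ler01. Qed.

Definition slot_at (R : realType) (x : R) : cinterval R :=
  CInterval (le_add1 x).

(* [e] is the end of the previous slot, -oo before the first one. The maximum
   is finite whenever [e] is not +oo, so [fine] only changes its type. *)
Fixpoint leftmost_from (R : realType) (e : \bar R) (W : seq (cinterval R)) :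
    seq (cinterval R) :=
  if W is w :: W' then
    let s := slot_at (fine (maxe (istart w)%:E e)) in
    s :: leftmost_from (iend s)%:E W'
  else [::].

Lemma size_leftmost (R : realType) (e : \bar R) (n : nat)
    (W : n.-tuple (cinterval R)) : size (leftmost_from e W) == n.
Proof.
apply/eqP; rewrite -[RHS](size_tuple W).
by elim: (tval W) e => //= w s IHs e; rewrite IHs.
Qed.

Definition Leftmost (R : realType) (Task : Type) (I : instance R Task) :
    (ntasks I).-tuple (cinterval R) :=
  Tuple (size_leftmost -oo%E (window I)).

(* Main.v *)
(** The leftmost slot [S[i]] ends a run of back-to-back slots [S[k], ..., S[i]]
    whose first one starts at [W[k].start].  In an ordered instance any solution
    [X] puts the [i - k + 1] disjoint unit slots [X[k], ..., X[i]] to the right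
    of [W[k].start], so [S[i].end = W[k].start + (i - k + 1)] is at most every
    common upper bound of the ends [X[j].end], [k <= j <= i].  The bound
    [W[i].end] gives feasibility of [S], and the bound [X[i].end], valid when [X]
    is ordered, gives its minimality. *)

Require Import Defs.
From HB Require Import structures.
From mathcomp Require Import all_boot all_order all_algebra.
From mathcomp Require Import all_classical all_reals all_analysis.
From mathcomp Require Import lra.
Import Order.TTheory GRing.Theory Num.Theory.

Set Implicit Arguments.
Unset Strict Implicit.
Unset Printing Implicit Defensive.

Local Open Scope classical_set_scope.
Local Open Scope ring_scope.

Section Packing.
Variables (R : realType) (T : eqType) (x : T -> R).

(** Separation concerns distinct labels, not distinct values of [x], so two labels at the same
    position violate it. *)
Definition unit_separated (s : seq T) : Prop :=
  {in s &, forall j k, j != k -> 1 <= `|x j - x k|}.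

(** Along a path nondecreasing in [x] each distance is a plain difference, so each of the [size s]
    steps advances by at least 1. *)
Lemma unit_separated_path_span (j : T) (s : seq T) :
  path (fun j k => x j <= x k) j s -> uniq (j :: s) ->
  unit_separated (j :: s) -> x j + (size s)%:R <= x (last j s).
Proof.
elim: s j => [|k s IHs] j /=; first by rewrite addr0.
move=> /andP[jk ks] /andP[js us] sep.
have {}IHs : x k + (size s)%:R <= x (last k s).
  by apply: IHs => // a b ia ib; apply: sep; rewrite inE ?ia ?ib orbT.
have : 1 <= `|x j - x k|.
  apply: sep; rewrite ?inE ?eqxx ?orbT//.
  by apply: contraNneq js => ->; rewrite inE eqxx.
rewrite distrC ger0_norm ?subr_ge0// => gap.
rewrite -natr1; lra.
Qed.

(** Sorting by [x] leaves [size s - 1] gaps of length at least 1 between the extreme positions; the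
    remaining unit is the one after the last position, which still fits below [hi]. *)
Lemma unit_separated_span (s : seq T) (lo hi : R) :
  uniq s -> (0 < size s)%N -> unit_separated s ->
  {in s, forall j, lo <= x j} -> {in s, forall j, x j + 1 <= hi} ->
  lo + (size s)%:R <= hi.
Proof.
move=> us s0 sep lo_x x_hi.
pose r := fun j k => x j <= x k.
have mem_s : sort r s =i s by apply: mem_sort.
have : sorted r (sort r s) by apply: sort_sorted => j k; apply: le_total.
have : uniq (sort r s) by rewrite sort_uniq.
have : size (sort r s) = size s by rewrite size_sort.
case: (sort r s) mem_s => [|j t] mem_s /= sz; first by rewrite -sz in s0.
move=> ut st; have := unit_separated_path_span st ut.
have lo_j : lo <= x j by apply: lo_x; rewrite -mem_s mem_head.
have last_hi : x (last j t) + 1 <= hi by apply: x_hi; rewrite -mem_s mem_last.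
rewrite -sz -natr1 => span.
suff : x j + (size t)%:R <= x (last j t) by lra.
by apply: span => a b; rewrite !mem_s; apply: sep.
Qed.

End Packing.

Section Slots.
Variable R : realType.
Implicit Types X Y W : cinterval R.

Lemma overlapP X Y :
  overlap X Y <->
  exists z, istart X < z < iend X /\ istart Y < z < iend Y.
Proof.
rewrite /overlap /iset !interior_itv_bnd; split=> -[z] /=.
  by rewrite !in_itv /= => -[]; exists z.
by move=> zXY; exists z; rewrite /= !in_itv.
Qed.

Lemma slot_end X : is_slot X -> iend X = istart X + 1.
Proof. by rewrite /is_slot => <-; rewrite addrC subrK. Qed.

Lemma slot_separated X Y :
  is_slot X -> is_slot Y -> ~ overlap X Y -> 1 <= `|istart X - istart Y|.
Proof.
move=> /slot_end eX /slot_end eY nov; rewrite leNgt; apply/negP.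
rewrite ltr_norml => /andP[lo hi]; apply: nov; apply/overlapP.
(* The midpoint of the two centres: the starts differ by less than 1, so it lies within less than
   1/2 of each centre. *)
by exists ((istart X + istart Y + 1) / 2); rewrite eX eY; split; lra.
Qed.

Lemma iset_sub X W :
  iset X `<=` iset W <-> istart W <= istart X /\ iend X <= iend W.
Proof.
have leX := istart_le_iend X.
split; [move=> sub | move=> [lo hi] z].
  have := sub (istart X); have := sub (iend X).
  by rewrite /iset /= !in_itv /= !lexx leX => /(_ isT)/andP[_ ?] /(_ isT)/andP[].
rewrite /iset /= !in_itv /= => /andP[Xz zX].
by rewrite (le_trans lo Xz) (le_trans zX hi).
Qed.

End Slots.

Section LeftmostFrom.
Variable R : realType.
Implicit Types (e : \bar R) (W : seq (cinterval R)) (d : cinterval R).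

Lemma fine_maxK (r : R) e :
  e != +oo%E -> (fine (maxe r%:E e))%:E = maxe r%:E e.
Proof. by case: e => [s| |] //= _; rewrite -?EFin_max ?maxeNy. Qed.

Lemma size_leftmost_from e W : size (leftmost_from e W) = size W.
Proof. exact/eqP/(size_leftmost e (in_tuple W)). Qed.

Lemma leftmost_from_slot e W i d :
  (i < size W)%N -> is_slot (nth d (leftmost_from e W) i).
Proof.
elim: W i e => [|w W IHW] [|i] e //= iW; last exact: IHW.
by rewrite /is_slot /= addrAC subrr add0r.
Qed.

Lemma leftmost_from_ge e W : e != +oo%E ->
  all (fun X => (e <= (istart X)%:E)%E) (leftmost_from e W).
Proof.
elim: W e => //= w W IHW e e_fin.
have le_e : (e <= (fine (maxe (istart w)%:E e))%:E)%E.
  by rewrite fine_maxK// le_max lexx orbT.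
rewrite le_e /=; apply: sub_all (IHW _ _) => // X.
by apply: le_trans; rewrite (le_trans le_e)// lee_fin le_add1.
Qed.

Lemma leftmost_from_sequential e W :
  pairwise (fun X Y => iend X <= istart Y) (leftmost_from e W).
Proof.
elim: W e => //= w W IHW e; rewrite IHW andbT.
by apply: sub_all (leftmost_from_ge _ _).
Qed.

Lemma leftmost_from_window_start e W i d : e != +oo%E -> (i < size W)%N ->
  istart (nth d W i) <= istart (nth d (leftmost_from e W) i).
Proof.
elim: W i e => [|w W IHW] [|i] e //= e_fin iW; last exact: IHW.
by rewrite -lee_fin fine_maxK// le_max lexx.
Qed.

(** Tracing back from slot [i], a back-to-back run ends either at the initial bound [e] or at a slot
    [k] that starts with its window. The first case is stated in [\bar R] because [e] may be
    [-oo]. *)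
Lemma leftmost_from_run e W i d : e != +oo%E -> (i < size W)%N ->
  let s := istart (nth d (leftmost_from e W) i) in
  s%:E = (e + i%:R%:E)%E \/
  exists2 k, (k <= i)%N & s = istart (nth d W k) + (i - k)%:R.
Proof.
elim: W i e => [|w W IHW] [|i] e //= e_fin iW.
  rewrite fine_maxK// adde0; case: (leP (istart w)%:E e) => _; first by left.
  by right; exists 0; rewrite ?addr0.
have [run|[k ki ->]] := IHW i (fine (maxe (istart w)%:E e) + 1)%:E isT iW.
  (* The run reaches back to the head slot; the maximum there decides whether it continues to [e] or
     starts at the head's window, with [k = 0]. *)
  move: run; rewrite EFinD fine_maxK//; case: (leP (istart w)%:E e) => _ run.
    by left; rewrite run -addeA -EFinD [1 + _]addrC natr1.
  right; exists 0 => //; apply: EFin_inj.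
  by rewrite run -!EFinD /= subn0 -addrA [1 + _]addrC natr1.
by right; exists k.+1; rewrite ?subSS.
Qed.

End LeftmostFrom.

Section Leftmost.
Variables (R : realType) (Task : Type) (I : instance R Task).
Let n := ntasks I.
Implicit Types (X : n.-tuple (cinterval R)) (i j k : 'I_n).

Lemma leftmost_slot i : is_slot (tnth (Leftmost I) i).
Proof.
rewrite (tnth_nth (tnth (window I) i)).
by apply: leftmost_from_slot; rewrite size_tuple.
Qed.

Lemma leftmost_window_start i :
  istart (tnth (window I) i) <= istart (tnth (Leftmost I) i).
Proof.
have d := tnth (window I) i; rewrite !(tnth_nth d).
by apply: leftmost_from_window_start; rewrite ?size_tuple.
Qed.

Lemma leftmost_sequential i j : (i < j)%N ->
  iend (tnth (Leftmost I) i) <= istart (tnth (Leftmost I) j).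
Proof.
move=> ij; have d := tnth (window I) i; rewrite !(tnth_nth d).
apply: (pairwiseP _ (leftmost_from_sequential -oo%E (window I))) => //;
  by rewrite inE size_leftmost_from size_tuple.
Qed.

Lemma leftmost_run i : exists2 k : 'I_n, (k <= i)%N &
  iend (tnth (Leftmost I) i) = istart (tnth (window I) k) + (i - k).+1%:R.
Proof.
have d := tnth (window I) i.
rewrite (slot_end (leftmost_slot i)) (tnth_nth d).
have iW : (i < size (window I))%N by rewrite size_tuple.
(* From [-oo] the first alternative is absurd, since the start is a real number. *)
have [//|[m mi ->]] := leftmost_from_run d (e := -oo%E) isT iW.
exists (Ordinal (leq_ltn_trans mi (ltn_ord i))) => //.
by rewrite (tnth_nth d) -addrA natr1.
Qed.

Lemma ordered_window_ile : ordered_instance I ->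
  forall k j : 'I_n, (k <= j)%N -> ile (tnth (window I) k) (tnth (window I) j).
Proof.
move=> ordW k j; rewrite leq_eqVlt => /predU1P[/val_inj->|kj].
  by rewrite /ile !lexx.
have d := tnth (window I) k; rewrite !(tnth_nth d).
by apply: (pairwiseP d ordW); rewrite ?inE ?size_tuple.
Qed.

Lemma leftmost_end_le X i (hi : R) :
  ordered_instance I -> is_solution I X ->
  (forall j, (j <= i)%N -> iend (tnth X j) <= hi) ->
  iend (tnth (Leftmost I) i) <= hi.
Proof.
move=> ordW [slotX subX sepX] X_hi; have [k ki ->] := leftmost_run i.
(* The indices from [k] to [i] as ordinals; [insub] drops none of them because [i < n]. *)
pose s : seq 'I_n := pmap insub (iota k (i - k).+1).
have mem_s j : (j \in s) = (k <= j <= i)%N.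
  by rewrite mem_pmap_sub mem_iota addnS subnKC.
have size_s : size s = (i - k).+1.
  rewrite size_pmap_sub -[RHS](size_iota k); apply/eqP; rewrite -all_count.
  apply/allP => m; rewrite mem_iota addnS subnKC// => /andP[_ mi].
  exact: leq_trans mi (ltn_ord i).
rewrite -size_s; apply: (@unit_separated_span _ _ (fun j => istart (tnth X j))).
- by rewrite pmap_sub_uniq ?iota_uniq.
- by rewrite size_s.
- by move=> a b _ _ ab; apply: slot_separated (sepX _ _ ab).
- move=> j; rewrite mem_s => /andP[kj _].
  (* The order of the windows makes [W[k].start] a common lower bound: [W[k].start <= W[j].start <=
     X[j].start]. *)
  have /andP[Wkj _] := ordered_window_ile ordW kj.
  by apply: (le_trans Wkj); have /iset_sub[] := subX j.
- move=> j; rewrite mem_s => /andP[_ ji].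
  by rewrite -slot_end// X_hi.
Qed.

End Leftmost.

Theorem mainTheorem4 (R : realType) (Task : Type) (I : instance R Task)
    (I_feasible : feasible I) (I_ordered : ordered_instance I) :
  ordered_solution I (Leftmost I) /\
  (forall X : (ntasks I).-tuple (cinterval R), ordered_solution I X ->
     forall i : 'I_(ntasks I), ile (tnth (Leftmost I) i) (tnth X i)).
Proof.
split=> [|X [solX ordX] i].
  have [X solX] := I_feasible; have [_ subX _] := solX.
  split; last first.
    apply/(pairwiseP (slot_at 0)) => i j; rewrite !inE size_tuple => iS jS ij.
    have /= := @leftmost_sequential _ _ I (Ordinal iS) (Ordinal jS) ij.
    (* Both inequalities follow from the chain [S[i].start <= S[i].end <= S[j].start <=
       S[j].end]. *)
    rewrite !(tnth_nth (slot_at 0)) /= /ile => seq_ij.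
    have := istart_le_iend (nth (slot_at 0) (Leftmost I) i).
    have := istart_le_iend (nth (slot_at 0) (Leftmost I) j).
    by move=> /= jj ii; apply/andP; split; lra.
  split=> [|i|i j ij]; first exact: leftmost_slot.
    apply/iset_sub; split; first exact: leftmost_window_start.
    (* Here [hi] is [W[i].end], and [X[j].end <= W[j].end <= W[i].end] for [j <= i]. *)
    apply: (leftmost_end_le I_ordered solX) => j ji.
    have /iset_sub[_ jX] := subX j.
    by have /andP[_] := ordered_window_ile I_ordered ji; apply: le_trans.
  move=> /overlapP[z [/andP[iz zi] /andP[jz zj]]].
  case: (ltngtP i j) => [lt_ij|lt_ji|/val_inj eq_ij].
  - by have := leftmost_sequential lt_ij; lra.
  - by have := leftmost_sequential lt_ji; lra.
  - by rewrite eq_ij eqxx in ij.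
have [slotX _ _] := solX.
(* Both intervals have length 1, so comparing ends also compares starts. *)
suff le_end : iend (tnth (Leftmost I) i) <= iend (tnth X i).
  rewrite /ile le_end andbT -(lerD2r 1).
  by rewrite -(slot_end (slotX i)) -(slot_end (leftmost_slot i)).
(* Now [hi] is [X[i].end], which bounds the earlier ends because [X] is ordered. *)
apply: (leftmost_end_le I_ordered solX) => j.
rewrite leq_eqVlt => /predU1P[/val_inj->//|ji].
have /andP[_ //] : ile (tnth X j) (tnth X i).
rewrite !(tnth_nth (slot_at 0)).
by apply: (pairwiseP (slot_at 0) ordX); rewrite ?inE ?size_tuple.
Qed.
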